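(* Let $m>0$, $0<k\leq 1$ and $0\leq\lambda<1$. Then the function $$\mathcal{G}(m,z)=\int_{0}^{z}\frac{\mathcal{F}(m,t)}{t}\,dt,\qquad\text{where } \mathcal{F}(m,z)=z-\sum_{n=2}^{\infty}\frac{m^{n-1}}{(n-1)!}e^{-m}z^{n},$$ is in $\mathcal{C}(k,\lambda)$ if and only if $$\big((1-\lambda)+k(1+\lambda)\big)\,m e^{m}\leq 2k.$$
   Context: Let $\mathcal{U}=\{z\in\mathbb{C}:|z|<1\}$. Let $\mathcal{A}$ be the class of functions $f(z)=z+\sum_{n=2}^{\infty}a_nz^n$ analytic in $\mathcal{U}$, and let $\mathcal{T}$ be the subclass of $\mathcal{A}$ of functions of the form $f(z)=z-\sum_{n=2}^{\infty}|a_n|z^n$, $z\in\mathcal{U}$. For $0<k\leq1$ and $0\leq\lambda<1$, a function $f$ of the form $f(z)=z-\sum_{n=2}^{\infty}|a_n|z^n$ (i.e. $f\in\mathcal{T}$) is in $\mathcal{S}(k,\lambda)$ if $$\left|\frac{\frac{zf'(z)}{(1-\lambda)f(z)+\lambda zf'(z)}-1}{\frac{zf'(z)}{(1-\lambda)f(z)+\lambda zf'(z)}+1}\right|<k\qquad (z\in\mathcal{U}),$$ and $f\in\mathcal{C}(k,\lambda)$ if and only if $zf'\in\mathcal{S}(k,\lambda)$. *)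

(* Defs.v *)
From Stdlib Require Import Reals Factorial.
From Coquelicot Require Import Coquelicot.
Local Open Scope C_scope.

Definition unit_disc (z : C) : Prop := (Cmod z < 1)%R.

Definition C_differentiable (f : C -> C) (z : C) : Prop :=
  @ex_derive C_AbsRing C_NormedModule f z.

Definition is_C_series (u : nat -> C) (s : C) : Prop :=
  @is_series C_AbsRing C_NormedModule u s.

(* The sum as a total function, unspecified when the series diverges
   (the pattern of [RInt]). *)
Definition C_Series (u : nat -> C) : C :=
  @iota C_CompleteNormedModule (is_C_series u).

(* The terms [a_n z^n] with [n >= 2], reindexed from 0. *)
Definition tail_terms (a : nat -> C) (z : C) (n : nat) : C :=
  a (n + 2)%nat * z ^ (n + 2).

(* Analyticity is stated as complex differentiability on the open disc.
   Functions are total on [C], but only their values on the disc matter. *)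
Definition class_A (f : C -> C) : Prop :=
  (forall z, unit_disc z -> C_differentiable f z) /\
  exists a : nat -> C, forall z, unit_disc z ->
    exists s, is_C_series (tail_terms a z) s /\ f z = z + s.

Definition class_T (f : C -> C) : Prop :=
  class_A f /\
  exists a : nat -> C, forall z, unit_disc z ->
    exists s, is_C_series (tail_terms (fun n => RtoC (Cmod (a n))) z) s /\
              f z = z - s.

Definition S_denominator (lambda : R) (f : C -> C) (z : C) : C :=
  (1 - RtoC lambda) * f z + RtoC lambda * (z * C_derive f z).

(* For [f z = z + a_2 z^2 + ...] the quotient has a removable singularity at 0,
   where its value is 1. *)
Definition S_quotient (lambda : R) (f : C -> C) (z : C) : C :=
  if Ceq_dec z 0 then 1 else z * C_derive f z / S_denominator lambda f z.

(* Division is total in [C], so both divisors are required to be nonzero. *)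
Definition class_S (k lambda : R) (f : C -> C) : Prop :=
  class_T f /\
  forall z, unit_disc z ->
    (z <> 0 -> S_denominator lambda f z <> 0) /\
    S_quotient lambda f z + 1 <> 0 /\
    (Cmod ((S_quotient lambda f z - 1) / (S_quotient lambda f z + 1)) < k)%R.

Definition class_C (k lambda : R) (f : C -> C) : Prop :=
  class_T f /\ class_S k lambda (fun z => z * C_derive f z).

Definition poisson_coef (m : R) (n : nat) : R :=
  (m ^ (n - 1) / INR (fact (n - 1)) * exp (- m))%R.

Definition poisson_F (m : R) (z : C) : C :=
  z - C_Series (tail_terms (fun n => RtoC (poisson_coef m n)) z).

(* The integral of [h] from 0 to [z] along the segment [s * z], [0 <= s <= 1]. *)
Definition segment_integral (h : C -> C) (z : C) : C :=
  @RInt C_R_CompleteNormedModule (fun s : R => h (RtoC s * z) * z) 0 1.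

(* The integrand is singular only at [t = 0], removably: its value there
   affects neither the existence nor the value of the integral. *)
Definition poisson_G (m : R) (z : C) : C :=
  segment_integral (fun t => poisson_F m t / t) z.

(* Main.v *)
(* With c = e^{-m}, summation gives F(m,z) = z p(z) for p(z) = 1 + c - c e^{mz}, and
   G is a primitive of p, so z G' = F.  Writing t = z p'(z), the quantity compared
   with k for f = F is (1 - lambda) t / (2 p + (1 + lambda) t).  On the disc |p| > c
   and |t| <= m, while the condition reads ((1 - lambda) + k (1 + lambda)) m <= 2 k c;
   this gives sufficiency.  If the condition fails, the intermediate value theorem on
   [0,1] yields a real r in (0,1) where the modulus equals k. *)

Require Import Defs.
From Stdlib Require Import Reals Factorial Lra Lia FunctionalExtensionality.
From Coquelicot Require Import Coquelicot.
Open Scope R_scope.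

(** * Complex series, and a criterion for differentiability *)

Lemma C_Series_unique (u : nat -> C) (s : C) :
  is_C_series u s -> C_Series u = s.
Proof.
  intros Hs.
  exact (iota_filterlim_locally (V := C_CompleteNormedModule) (sum_n u) s Hs).
Qed.

Lemma is_C_series_ext (u v : nat -> C) (s : C) :
  (forall n, u n = v n) -> is_C_series u s -> is_C_series v s.
Proof. apply is_series_ext. Qed.

Lemma is_C_series_scal (c : C) (u : nat -> C) (s : C) :
  is_C_series u s -> is_C_series (fun n => (c * u n)%C) (c * s)%C.
Proof. exact (is_series_scal (V := C_NormedModule) c u s). Qed.

Lemma is_C_series_RtoC (u : nat -> R) (s : R) :
  is_series u s -> is_C_series (fun n => RtoC (u n)) (RtoC s).
Proof.
  intros Hs.
  apply (filterlim_ext (fun n => RtoC (sum_n u n))).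
  { intros n; induction n as [|n IH].
    - now rewrite !sum_O.
    - rewrite !sum_Sn, <- IH. apply RtoC_plus. }
  apply (filterlim_comp _ _ _ (sum_n u) RtoC _ (locally s)); [exact Hs|].
  apply filterlim_locally; intros eps.
  exists eps; intros y Hy; split; [exact Hy | apply ball_center].
Qed.

Lemma is_C_series_Cmod_le (u : nat -> C) (b : nat -> R) (s : C) (t : R) :
  (forall n, Cmod (u n) <= b n) -> is_C_series u s -> is_series b t ->
  Cmod s <= t.
Proof.
  intros Hub Hs Ht.
  assert (HN : is_lim_seq (fun n => Cmod (sum_n (u : nat -> C_NormedModule) n)) (Cmod s)).
  { exact (filterlim_comp _ _ _ (sum_n (u : nat -> C_NormedModule)) norm _ _ _ Hs
             (filterlim_norm (V := C_NormedModule) s)). }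
  refine (is_lim_seq_le _ _ (Cmod s) t _ HN Ht); intros n.
  apply Rle_trans with (1 := norm_sum_n_m (u : nat -> C_NormedModule) 0 n).
  apply sum_n_m_le; exact Hub.
Qed.

(** An error [M d^2] is at most [eps * d] once [d < eps / M]. The general [K] and [V] cover both
    complex derivatives and derivatives of curves from [R] to [C]. *)
Lemma is_derive_of_quadratic {K : AbsRing} {V : NormedModule K}
    (f : K -> V) (x : K) (l : V) (M r : R) :
  0 < r ->
  (forall y, norm (minus y x) < r ->
    norm (minus (minus (f y) (f x)) (scal (minus y x) l))
      <= M * norm (minus y x) ^ 2) ->
  is_derive f x l.
Proof.
  intros Hr HM; split; [apply is_linear_scal_l|].
  intros x' Hx'.
  assert (Hxx' : x = x')
    by exact (is_filter_lim_locally_unique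
                (V := AbsRing_NormedModule K) x x' Hx').
  subst x'.
  intros [eps Heps]; simpl.
  (* [M] may be zero or negative; [N] can safely serve as a divisor. *)
  set (N := Rmax M 1).
  assert (HN : 0 < N) by (apply Rlt_le_trans with 1; [lra | apply Rmax_r]).
  assert (Hd : 0 < Rmin r (eps / N))
    by (apply Rmin_pos; [exact Hr | apply Rdiv_lt_0_compat; assumption]).
  exists (mkposreal _ Hd); intros y Hy.
  change (norm (minus y x) < Rmin r (eps / N)) in Hy.
  apply Rle_trans with (1 := HM y (Rlt_le_trans _ _ _ Hy (Rmin_l _ _))).
  assert (Hn := norm_ge_0 (minus y x)).
  assert (Hy2 := Rlt_le_trans _ _ _ Hy (Rmin_r _ _)).
  assert (HNe : N * (eps / N) = eps) by (field; lra).
  assert (HMN : M <= N) by apply Rmax_l.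
  set (d := norm (minus y x)) in *.
  apply Rle_trans with (N * d * d); [nra|].
  apply Rmult_le_compat_r; [assumption|]. nra.
Qed.

(** * The complex exponential as a power series *)

Definition C_exp_terms (w : C) (n : nat) : C := (RtoC (/ INR (fact n)) * w ^ n)%C.

Definition C_exp (w : C) : C := C_Series (C_exp_terms w).

Lemma is_series_exp (x : R) : is_series (fun n => / INR (fact n) * x ^ n) (exp x).
Proof.
  apply (is_series_ext (fun n => scal (pow_n x n) (/ INR (fact n)))).
  - intros n. rewrite pow_n_pow. apply Rmult_comm.
  - exact (is_exp_Reals x).
Qed.

Lemma inv_fact_pos (n : nat) : 0 < / INR (fact n).
Proof. apply Rinv_0_lt_compat, INR_fact_lt_0. Qed.

Lemma Cmod_exp_terms (w : C) (n : nat) :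
  Cmod (C_exp_terms w n) = / INR (fact n) * Cmod w ^ n.
Proof.
  unfold C_exp_terms.
  rewrite Cmod_mult, Cmod_pow, Cmod_R, Rabs_pos_eq; [reflexivity|].
  apply Rlt_le, inv_fact_pos.
Qed.

Lemma C_exp_series (w : C) : is_C_series (C_exp_terms w) (C_exp w).
Proof.
  assert (H : ex_series (V := C_NormedModule) (C_exp_terms w)).
  { apply (ex_series_le (V := C_CompleteNormedModule) _
             (fun n => / INR (fact n) * Cmod w ^ n)).
    - intros n; apply Req_le, Cmod_exp_terms.
    - eexists; apply is_series_exp. }
  destruct H as [s Hs].
  unfold C_exp; rewrite (C_Series_unique _ s Hs); exact Hs.
Qed.

Lemma Cmod_exp_le (w : C) : Cmod (C_exp w) <= exp (Cmod w).
Proof.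
  apply (is_C_series_Cmod_le _ _ _ _
           (fun n => Req_le _ _ (Cmod_exp_terms w n))
           (C_exp_series w) (is_series_exp (Cmod w))).
Qed.

Lemma C_exp_RtoC (x : R) : C_exp (RtoC x) = RtoC (exp x).
Proof.
  apply C_Series_unique.
  refine (is_C_series_ext _ _ _ _ (is_C_series_RtoC _ _ (is_series_exp x))).
  intros n; unfold C_exp_terms. now rewrite RtoC_mult, RtoC_pow.
Qed.

Lemma C_exp_series_S (w : C) :
  is_C_series (fun n => C_exp_terms w (S n)) (C_exp w - 1)%C.
Proof.
  apply (is_series_incr_1 (V := C_NormedModule) (C_exp_terms w)).
  replace (plus _ _ : C_NormedModule) with (C_exp w).
  - apply C_exp_series.
  - change (C_exp w = C_exp w - 1 + RtoC (/ 1) * 1)%C.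
    rewrite Rinv_1. ring.
Qed.

Lemma C_exp_series_SS (w : C) :
  is_C_series (fun n => C_exp_terms w (S (S n))) (C_exp w - 1 - w)%C.
Proof.
  apply (is_series_incr_1 (V := C_NormedModule) (fun n => C_exp_terms w (S n))).
  replace (plus _ _ : C_NormedModule) with (C_exp w - 1)%C.
  - apply C_exp_series_S.
  - change (C_exp w - 1 = C_exp w - 1 - w + RtoC (/ 1) * (w * 1))%C.
    rewrite Rinv_1. ring.
Qed.

(** Induction on the Taylor remainders [R_N] of [w^N] at [z], which satisfy
    [R_(N+1) = (z + h) R_N + N h^2 z^(N-1)]. The factor [(n+2)(n+1)] is twice the sharp one, but it
    cancels neatly against [(n+2)!]. *)
Lemma Cmod_pow_remainder_le (z h : C) (n : nat) :
  Cmod ((z + h) ^ S (S n) - z ^ S (S n) - h * (RtoC (INR (S (S n))) * z ^ S n))%C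
    <= INR (S (S n)) * INR (S n) * (Cmod h ^ 2 * (Cmod z + Cmod h) ^ n).
Proof.
  assert (Hz := Cmod_ge_0 z); assert (Hh := Cmod_ge_0 h).
  induction n as [|n IH].
  - replace ((z + h) ^ 2 - z ^ 2 - h * (RtoC (INR 2) * z ^ 1))%C with (h ^ 2)%C
      by (simpl INR; rewrite RtoC_plus; ring).
    rewrite Cmod_pow; simpl INR; simpl pow. nra.
  - replace ((z + h) ^ S (S (S n)) - z ^ S (S (S n))
             - h * (RtoC (INR (S (S (S n)))) * z ^ S (S n)))%C
      with ((z + h) * ((z + h) ^ S (S n) - z ^ S (S n)
                       - h * (RtoC (INR (S (S n))) * z ^ S n))
            + RtoC (INR (S (S n))) * h ^ 2 * z ^ S n)%C
      by (rewrite (S_INR (S (S n))), RtoC_plus; simpl Cpow; ring).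
    assert (Hr : 0 <= INR (S n)) by apply pos_INR.
    apply Rle_trans with (1 := Cmod_triangle _ _).
    rewrite !Cmod_mult, Cmod_R, Rabs_pos_eq, !Cmod_pow by apply pos_INR.
    assert (H1 := Cmod_triangle z h).
    assert (H2 : Cmod z ^ S n <= (Cmod z + Cmod h) ^ S n) by (apply pow_incr; lra).
    apply Rle_trans with
      ((Cmod z + Cmod h) * (INR (S (S n)) * INR (S n) * (Cmod h ^ 2 * (Cmod z + Cmod h) ^ n))
       + INR (S (S n)) * Cmod h ^ 2 * (Cmod z + Cmod h) ^ S n).
    + apply Rplus_le_compat.
      * apply Rmult_le_compat; auto using Cmod_ge_0.
      * apply Rmult_le_compat_l; [|exact H2].
        apply Rmult_le_pos; [apply pos_INR | apply pow2_ge_0].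
    (* The coefficients add up to [(n+2)(n+1) + (n+2) = (n+2)^2], at most [(n+3)(n+2)]. *)
    + rewrite (S_INR (S (S n))), (S_INR (S n)).
      assert (H3 : 0 <= Cmod h ^ 2 * (Cmod z + Cmod h) ^ S n)
        by (apply Rmult_le_pos; apply pow_le; lra).
      simpl pow in *. nra.
Qed.

(** The power remainders are summed termwise: after division by [(n+2)!] the bounds become
    [|h|^2 (|z|+|h|)^n / n!], an exponential series. *)
Lemma C_exp_remainder_le (z h : C) :
  Cmod (C_exp (z + h) - C_exp z - h * C_exp z)%C
    <= Cmod h ^ 2 * exp (Cmod z + Cmod h).
Proof.
  (* Removing the terms of degree below 2, and the constant term of the factor of [h], aligns degree
     [n+2] with its derivative of degree [n+1]. *)
  replace (C_exp (z + h) - C_exp z - h * C_exp z)%C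
    with ((C_exp (z + h) - 1 - (z + h)) - (C_exp z - 1 - z) - h * (C_exp z - 1))%C
    by ring.
  refine (is_C_series_Cmod_le
    (fun n => C_exp_terms (z + h) (S (S n)) - C_exp_terms z (S (S n))
              - h * C_exp_terms z (S n))%C
    (fun n => Cmod h ^ 2 * (/ INR (fact n) * (Cmod z + Cmod h) ^ n)) _ _ _ _ _).
  - intros n.
    assert (Hf := inv_fact_pos (S (S n))).
    assert (Hf1 : / INR (fact (S n)) = / INR (fact (S (S n))) * INR (S (S n))).
    { rewrite (fact_simpl (S n)), mult_INR. field.
      split; [apply INR_fact_neq_0 | apply not_0_INR; lia]. }
    assert (Hf0 : / INR (fact n) = / INR (fact (S (S n))) * (INR (S (S n)) * INR (S n))).
    { rewrite (fact_simpl (S n)), (fact_simpl n), !mult_INR. field.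
      repeat split; (apply INR_fact_neq_0 || (apply not_0_INR; lia)). }
    unfold C_exp_terms; rewrite Hf0, Hf1, RtoC_mult.
    match goal with |- Cmod ?w <= _ =>
      replace w with (RtoC (/ INR (fact (S (S n)))) *
        ((z + h) ^ S (S n) - z ^ S (S n) - h * (RtoC (INR (S (S n))) * z ^ S n)))%C
      by ring end.
    rewrite Cmod_mult, Cmod_R, Rabs_pos_eq by lra.
    assert (H := Cmod_pow_remainder_le z h n).
    apply Rle_trans with (1 := Rmult_le_compat_l _ _ _ (Rlt_le _ _ Hf) H).
    apply Req_le; ring.
  - apply (is_series_minus (V := C_NormedModule)).
    + apply (is_series_minus (V := C_NormedModule)); apply C_exp_series_SS.
    + apply is_C_series_scal, C_exp_series_S.
  - apply (is_series_scal (V := R_NormedModule)), is_series_exp.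
Qed.

(** * Derivatives with quadratic error *)

(* A quadratic error bound serves both the complex derivative and the derivative
   along a ray, whose target carries a different module structure on [C]. *)
Definition quad_derivable (f : C -> C) (z l : C) : Prop :=
  exists M, forall h, Cmod h <= 1 ->
    Cmod (f (z + h) - f z - h * l)%C <= M * Cmod h ^ 2.

Lemma quad_derivable_is_derive (f : C -> C) (z l : C) :
  quad_derivable f z l -> is_derive (K := C_AbsRing) (V := C_NormedModule) f z l.
Proof.
  intros [M HM].
  apply (is_derive_of_quadratic (V := C_NormedModule) f z l M 1); [lra|].
  intros y Hy.
  change (Cmod (y - z)%C < 1) in Hy.
  change (Cmod (f y - f z - (y - z) * l)%C <= M * Cmod (y - z)%C ^ 2).
  replace (f y) with (f (z + (y - z))%C) by (f_equal; ring).
  apply HM; lra.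
Qed.

Lemma quad_derivable_ray (f : C -> C) (z l : C) (s : R) :
  quad_derivable f (RtoC s * z)%C l ->
  is_derive (V := C_R_NormedModule) (fun t : R => f (RtoC t * z)%C) s (l * z)%C.
Proof.
  intros [M HM].
  assert (Hz := Cmod_ge_0 z).
  (* The radius [/ (1 + Cmod z)] keeps the increment [(t - s) z] within modulus 1, where the bound
     of [quad_derivable] applies. *)
  apply (is_derive_of_quadratic (V := C_R_NormedModule) _ s _
           (M * Cmod z ^ 2) (/ (1 + Cmod z))).
  { apply Rinv_0_lt_compat; lra. }
  intros t Ht.
  change (Rabs (t - s) < / (1 + Cmod z)) in Ht.
  change (norm (minus t s)) with (Rabs (t - s)).
  rewrite <- Cmod_norm, scal_R_Cmult.
  change (Cmod (f (RtoC t * z) - f (RtoC s * z) - RtoC (t - s) * (l * z))%C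
            <= M * Cmod z ^ 2 * Rabs (t - s) ^ 2).
  specialize (HM (RtoC (t - s) * z)%C).
  rewrite Cmod_mult, Cmod_R in HM.
  replace (RtoC s * z + RtoC (t - s) * z)%C with (RtoC t * z)%C in HM
    by (rewrite RtoC_minus; ring).
  replace (RtoC (t - s) * (l * z))%C with (RtoC (t - s) * z * l)%C by ring.
  apply Rle_trans with (M * (Rabs (t - s) * Cmod z) ^ 2); [apply HM | apply Req_le; ring].
  assert (H0 := Rabs_pos (t - s)).
  assert (H1 : / (1 + Cmod z) * (1 + Cmod z) = 1) by (field; lra).
  nra.
Qed.

Lemma quad_derivable_mul_const (f : C -> C) (c z l : C) :
  quad_derivable f z l -> quad_derivable (fun w => f w * c)%C z (l * c)%C.
Proof.
  intros [M HM]; exists (M * Cmod c); intros h Hh.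
  replace (f (z + h) * c - f z * c - h * (l * c))%C
    with ((f (z + h) - f z - h * l) * c)%C by ring.
  rewrite Cmod_mult.
  replace (M * Cmod c * Cmod h ^ 2) with (M * Cmod h ^ 2 * Cmod c) by ring.
  apply Rmult_le_compat_r; [apply Cmod_ge_0 | exact (HM h Hh)].
Qed.

Lemma exp_monotone (x y : R) : x <= y -> exp x <= exp y.
Proof.
  intros [H | ->]; [apply Rlt_le, exp_increasing, H | apply Rle_refl].
Qed.

Lemma exp_mul_exp_opp (x : R) : exp x * exp (- x) = 1.
Proof. rewrite <- exp_plus, Rplus_opp_r; apply exp_0. Qed.

(** The affine part has no error, so the remainder is [d] times that of the exponential for the
    increment [m h]. This single shape covers both [G] and the slope [F(m,z)/z]. *)
Lemma quad_derivable_affine_exp (a b d : C) (m : R) (z : C) : 0 <= m ->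
  quad_derivable (fun z => a * z + b + d * C_exp (RtoC m * z))%C z
    (a + d * RtoC m * C_exp (RtoC m * z))%C.
Proof.
  intros Hm.
  exists (Cmod d * (m ^ 2 * exp (m * Cmod z + m))); intros h Hh.
  match goal with |- Cmod ?w <= _ =>
    replace w with (d * (C_exp (RtoC m * z + RtoC m * h) - C_exp (RtoC m * z)
                         - RtoC m * h * C_exp (RtoC m * z)))%C end.
  2: { replace (RtoC m * (z + h))%C with (RtoC m * z + RtoC m * h)%C by ring. ring. }
  rewrite Cmod_mult, Rmult_assoc.
  apply Rmult_le_compat_l; [apply Cmod_ge_0|].
  apply Rle_trans with (1 := C_exp_remainder_le _ _).
  rewrite !Cmod_mult, !Cmod_R, !(Rabs_pos_eq m) by exact Hm.
  replace ((m * Cmod h) ^ 2 * exp (m * Cmod z + m * Cmod h))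
    with (m ^ 2 * Cmod h ^ 2 * exp (m * Cmod z + m * Cmod h)) by ring.
  replace (m ^ 2 * exp (m * Cmod z + m) * Cmod h ^ 2)
    with (m ^ 2 * Cmod h ^ 2 * exp (m * Cmod z + m)) by ring.
  apply Rmult_le_compat_l; [apply Rmult_le_pos; apply pow2_ge_0|].
  apply exp_monotone. nra.
Qed.

Lemma quad_derivable_mul_id (f : C -> C) (z l : C) :
  quad_derivable f z l -> quad_derivable (fun z => z * f z)%C z (f z + z * l)%C.
Proof.
  intros [M HM].
  exists (Cmod z * M + Rmax M 0 + Cmod l); intros h Hh.
  specialize (HM h Hh).
  assert (Hh0 := Cmod_ge_0 h).
  set (r := (f (z + h) - f z - h * l)%C) in *.
  replace ((z + h) * f (z + h) - z * f z - h * (f z + z * l))%C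
    with (z * r + (h * r + h * (h * l)))%C by (unfold r; ring).
  apply Rle_trans with (1 := Cmod_triangle _ _).
  apply Rle_trans with (1 := Rplus_le_compat_l _ _ _ (Cmod_triangle _ _)).
  rewrite !Cmod_mult.
  assert (H1 := Rmult_le_compat_l _ _ _ (Cmod_ge_0 z) HM).
  (* One factor [Cmod h] is bounded by 1; [Rmax M 0] makes the coefficient nonnegative. *)
  assert (H2 : Cmod h * Cmod r <= Rmax M 0 * Cmod h ^ 2).
  { assert (H3 : M <= Rmax M 0) by apply Rmax_l.
    assert (H4 : 0 <= Rmax M 0) by apply Rmax_r.
    assert (H5 := Cmod_ge_0 r). assert (H6 := pow2_ge_0 (Cmod h)).
    apply Rle_trans with (1 * Cmod r); [|nra].
    apply Rmult_le_compat_r; assumption. }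
  lra.
Qed.

(** * Closed forms of [F] and [G] *)

(* [F(m,z)/z]; the null linear term gives it the shape of [quad_derivable_affine_exp]. *)
Definition poisson_slope (m : R) (z : C) : C :=
  (0 * z + (1 + RtoC (exp (- m))) + (- RtoC (exp (- m))) * C_exp (RtoC m * z))%C.

(** The term in [z^(n+2)] is [e^{-m} z] times the term of index [n+1] of [e^{mz}]. Convergence is
    kept beside the value because membership in [class_T] asks for the series itself. *)
Lemma poisson_F_eq (m : R) (z : C) :
  is_C_series (tail_terms (fun n => RtoC (poisson_coef m n)) z)
    (z - z * poisson_slope m z)%C /\
  poisson_F m z = (z * poisson_slope m z)%C.
Proof.
  assert (H : is_C_series (tail_terms (fun n => RtoC (poisson_coef m n)) z)
                (z - z * poisson_slope m z)%C).
  { replace (z - z * poisson_slope m z)%C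
      with (RtoC (exp (- m)) * z * (C_exp (RtoC m * z) - 1))%C
      by (unfold poisson_slope; ring).
    apply (is_C_series_ext (fun n => RtoC (exp (- m)) * z * C_exp_terms (RtoC m * z) (S n))%C);
      [|apply is_C_series_scal, C_exp_series_S].
    intros n; unfold tail_terms, C_exp_terms, poisson_coef.
    replace (n + 2)%nat with (S (S n)) by lia.
    replace (S (S n) - 1)%nat with (S n) by lia.
    unfold Rdiv.
    rewrite !RtoC_mult, Cpow_mult_l, RtoC_pow, (Cpow_S z (S n)). ring. }
  split; [exact H|].
  unfold poisson_F; rewrite (C_Series_unique _ _ H). ring.
Qed.

(** The antiderivative of [poisson_slope m] that vanishes at 0; this fixes the constant
    [e^{-m}/m]. *)
Definition poisson_primitive (m : R) (z : C) : C :=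
  ((1 + RtoC (exp (- m))) * z + RtoC (exp (- m) / m)
   + (- RtoC (exp (- m) / m)) * C_exp (RtoC m * z))%C.

Lemma poisson_primitive_derivable (m : R) (z : C) : 0 < m ->
  quad_derivable (poisson_primitive m) z (poisson_slope m z).
Proof.
  intros Hm.
  replace (poisson_slope m z)
    with (1 + RtoC (exp (- m)) + - RtoC (exp (- m) / m) * RtoC m * C_exp (RtoC m * z))%C.
  - apply quad_derivable_affine_exp; lra.
  - unfold poisson_slope.
    replace (RtoC (exp (- m))) with (RtoC (exp (- m) / m) * RtoC m)%C at 3; [ring|].
    rewrite <- RtoC_mult; f_equal; field; lra.
Qed.

(** The leading 0 is the coefficient [a] of [quad_derivable_affine_exp], so that lemma applies
    verbatim. *)
Definition poisson_slope_deriv (m : R) (z : C) : C :=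
  (0 + - RtoC (exp (- m)) * RtoC m * C_exp (RtoC m * z))%C.

Lemma poisson_slope_derivable (m : R) (z : C) : 0 < m ->
  quad_derivable (poisson_slope m) z (poisson_slope_deriv m z).
Proof. intros Hm; apply quad_derivable_affine_exp; lra. Qed.

Lemma poisson_primitive_0 (m : R) : poisson_primitive m 0 = 0%C.
Proof.
  unfold poisson_primitive.
  rewrite !Cmult_0_r, C_exp_RtoC, exp_0. ring.
Qed.

(** The fundamental theorem of calculus along the segment: [s => poisson_primitive m (s z)] has
    derivative [poisson_slope m (s z) * z]. *)
Lemma poisson_G_eq (m : R) : 0 < m -> poisson_G m = poisson_primitive m.
Proof.
  intros Hm; apply functional_extensionality; intros z.
  unfold poisson_G, segment_integral.
  destruct (Ceq_dec z 0) as [->|Hz].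
  - rewrite poisson_primitive_0.
    rewrite (RInt_ext (V := C_R_CompleteNormedModule) _ (fun _ => RtoC 0))
      by (intros; apply Cmult_0_r).
    rewrite RInt_const. exact (scal_zero_r (V := C_R_NormedModule) _).
  - rewrite (RInt_ext (V := C_R_CompleteNormedModule) _
               (fun s => poisson_slope m (RtoC s * z) * z)%C).
    (* The integrands need only agree for [0 < s < 1], where [s z] is nonzero and cancels. *)
    2: { intros s Hs. rewrite Rmin_left, Rmax_right in Hs by lra.
         rewrite (proj2 (poisson_F_eq m _)).
         match goal with |- ?a = ?b => change (@eq C a b) end.
         field. split; [exact Hz|].
         intros H; apply RtoC_inj in H; lra. }
    apply (is_RInt_unique (V := C_R_CompleteNormedModule)).
    replace (poisson_primitive m z : C_R_CompleteNormedModule)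
      with (minus (poisson_primitive m (RtoC 1 * z)) (poisson_primitive m (RtoC 0 * z))
              : C_R_CompleteNormedModule).
    2: { rewrite Cmult_0_l, Cmult_1_l, poisson_primitive_0.
         exact (minus_zero_r (G := C_R_NormedModule) _). }
    apply (is_RInt_derive (V := C_R_CompleteNormedModule)
             (fun s => poisson_primitive m (RtoC s * z))).
    + intros s _. apply quad_derivable_ray, poisson_primitive_derivable, Hm.
    + intros s _.
      apply (ex_derive_continuous (V := C_R_NormedModule)).
      eexists.
      apply (quad_derivable_ray (fun w => poisson_slope m w * z)%C).
      apply quad_derivable_mul_const, poisson_slope_derivable, Hm.
Qed.

(** * Membership in [class_T] and reduction to a pointwise condition *)

(** A nonnegative [b n] is its own modulus, which settles the signed expansion; for [class_A] the
    coefficients are [- b n]. *)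
Lemma class_T_of_nonneg (f : C -> C) (b : nat -> R) :
  (forall n, 0 <= b n) ->
  (forall z, unit_disc z -> C_differentiable f z) ->
  (forall z, unit_disc z ->
     is_C_series (tail_terms (fun n => RtoC (b n)) z) (z - f z)%C) ->
  class_T f.
Proof.
  intros Hb Hd Hs; split; [split; [exact Hd|]|].
  - exists (fun n => (- RtoC (b n))%C); intros z Hz.
    exists (- (z - f z))%C; split; [|ring].
    apply (is_C_series_ext (fun n => opp (tail_terms (fun n => RtoC (b n)) z n) : C)).
    + intros n; unfold tail_terms.
      change (- (RtoC (b (n + 2)%nat) * z ^ (n + 2))
              = - RtoC (b (n + 2)%nat) * z ^ (n + 2))%C. ring.
    + exact (is_series_opp (V := C_NormedModule) _ _ (Hs z Hz)).
  - exists (fun n => RtoC (b n)); intros z Hz.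
    exists (z - f z)%C; split; [|ring].
    apply (is_C_series_ext (tail_terms (fun n => RtoC (b n)) z)); [|exact (Hs z Hz)].
    intros n; unfold tail_terms; now rewrite Cmod_R, Rabs_pos_eq by apply Hb.
Qed.

Lemma poisson_coef_nonneg (m : R) (n : nat) : 0 < m -> 0 <= poisson_coef m n.
Proof.
  intros Hm; unfold poisson_coef, Rdiv.
  apply Rmult_le_pos; [apply Rmult_le_pos|].
  - apply pow_le; lra.
  - apply Rlt_le, inv_fact_pos.
  - apply Rlt_le, exp_pos.
Qed.

Lemma poisson_primitive_class_T (m : R) : 0 < m -> class_T (poisson_primitive m).
Proof.
  intros Hm.
  (* These are the coefficients of [F] divided by [n], for [n >= 1]. *)
  apply (class_T_of_nonneg _ (fun n => exp (- m) / m * m ^ n * / INR (fact n))).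
  - intros n. apply Rmult_le_pos; [apply Rmult_le_pos|].
    + apply Rlt_le, Rdiv_lt_0_compat; [apply exp_pos | exact Hm].
    + apply pow_le; lra.
    + apply Rlt_le, inv_fact_pos.
  - intros z _; eexists.
    apply quad_derivable_is_derive, poisson_primitive_derivable, Hm.
  - intros z _.
    replace (z - poisson_primitive m z)%C
      with (RtoC (exp (- m) / m) * (C_exp (RtoC m * z) - 1 - RtoC m * z))%C.
    + apply (is_C_series_ext
               (fun n => RtoC (exp (- m) / m) * C_exp_terms (RtoC m * z) (S (S n)))%C);
        [|apply is_C_series_scal, C_exp_series_SS].
      intros n; unfold tail_terms, C_exp_terms.
      replace (n + 2)%nat with (S (S n)) by lia.
      rewrite !RtoC_mult, Cpow_mult_l, RtoC_pow. ring.
    + unfold poisson_primitive.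
      replace (RtoC (exp (- m))) with (RtoC (exp (- m) / m) * RtoC m)%C; [ring|].
      rewrite <- RtoC_mult; f_equal; field; lra.
Qed.

Lemma poisson_F_derivable (m : R) (z : C) : 0 < m ->
  quad_derivable (fun z => z * poisson_slope m z)%C z
    (poisson_slope m z + z * poisson_slope_deriv m z)%C.
Proof. intros Hm; apply quad_derivable_mul_id, poisson_slope_derivable, Hm. Qed.

Lemma poisson_F_class_T (m : R) : 0 < m ->
  class_T (fun z => z * poisson_slope m z)%C.
Proof.
  intros Hm.
  apply (class_T_of_nonneg _ (poisson_coef m)).
  - intros n; apply poisson_coef_nonneg, Hm.
  - intros z _; eexists.
    apply quad_derivable_is_derive, poisson_F_derivable, Hm.
  - intros z _; apply poisson_F_eq.
Qed.

(** Both [class_T] requirements hold for every [m > 0], and [z G' = F]; only the inequality of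
    [class_S] and its side conditions remain. *)
Lemma class_C_poisson_G_iff (m k lambda : R) : 0 < m ->
  class_C k lambda (poisson_G m) <->
  forall z, unit_disc z ->
    let f := (fun z => z * poisson_slope m z)%C in
    (z <> 0 -> S_denominator lambda f z <> 0) /\
    (S_quotient lambda f z + 1 <> 0)%C /\
    Cmod ((S_quotient lambda f z - 1) / (S_quotient lambda f z + 1))%C < k.
Proof.
  intros Hm; unfold class_C, class_S.
  rewrite (poisson_G_eq m Hm).
  replace (fun z => z * C_derive (poisson_primitive m) z)%C
    with (fun z => z * poisson_slope m z)%C.
  - split; [intros [_ [_ H]]; exact H|].
    intros H; split; [exact (poisson_primitive_class_T m Hm)|].
    split; [exact (poisson_F_class_T m Hm) | exact H].
  - apply functional_extensionality; intros z; f_equal; symmetry.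
    apply is_C_derive_unique, quad_derivable_is_derive, poisson_primitive_derivable, Hm.
Qed.

(** * The quotient of [class_S] for a function [z p(z)] *)

Lemma S_denominator_mul_id (lambda : R) (p : C -> C) (z l : C) :
  C_derive (fun z => z * p z)%C z = (p z + z * l)%C ->
  S_denominator lambda (fun z => z * p z)%C z = (z * (p z + RtoC lambda * (z * l)))%C.
Proof. intros H; unfold S_denominator; rewrite H; ring. Qed.

Lemma S_quotient_mul_id (lambda : R) (p : C -> C) (z l : C) :
  z <> 0 -> C_derive (fun z => z * p z)%C z = (p z + z * l)%C ->
  (p z + RtoC lambda * (z * l))%C <> 0 ->
  S_quotient lambda (fun z => z * p z)%C z
  = ((p z + z * l) / (p z + RtoC lambda * (z * l)))%C.
Proof.
  intros Hz H Hd; unfold S_quotient.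
  destruct (Ceq_dec z 0) as [E|_]; [contradiction|].
  rewrite (S_denominator_mul_id lambda p z l H), H. field. now split.
Qed.

Lemma poisson_F_C_derive (m : R) (z : C) : 0 < m ->
  C_derive (fun z => z * poisson_slope m z)%C z
  = (poisson_slope m z + z * poisson_slope_deriv m z)%C.
Proof.
  intros Hm; apply is_C_derive_unique, quad_derivable_is_derive, poisson_F_derivable, Hm.
Qed.

Lemma cayley_plus_1 (p t : C) (lambda : R) :
  (p + RtoC lambda * t)%C <> 0 ->
  ((p + t) / (p + RtoC lambda * t) + 1)%C
  = ((2 * p + RtoC (1 + lambda) * t) / (p + RtoC lambda * t))%C.
Proof. intros Hd; rewrite RtoC_plus; field; exact Hd. Qed.

(** Subtracting or adding 1 leaves the same denominator [p + lambda t], which cancels in the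
    ratio. *)
Lemma cayley_ratio (p t : C) (lambda : R) :
  (p + RtoC lambda * t)%C <> 0 -> (2 * p + RtoC (1 + lambda) * t)%C <> 0 ->
  (((p + t) / (p + RtoC lambda * t) - 1) / ((p + t) / (p + RtoC lambda * t) + 1))%C
  = (RtoC (1 - lambda) * t / (2 * p + RtoC (1 + lambda) * t))%C.
Proof.
  intros Hd Hn; rewrite cayley_plus_1 by exact Hd.
  rewrite RtoC_plus in *; rewrite RtoC_minus. field. now split.
Qed.

(** * Estimates on the disc and sufficiency *)

Lemma Cmod_add_ge (a b : C) : Cmod a - Cmod b <= Cmod (a + b)%C.
Proof.
  assert (H := Cmod_triangle (a + b) (- b)).
  replace (a + b + - b)%C with a in H by ring. rewrite Cmod_opp in H. lra.
Qed.

Lemma Cmod_exp_scal_lt (m : R) (z : C) : 0 < m -> unit_disc z ->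
  Cmod (C_exp (RtoC m * z)) < exp m.
Proof.
  intros Hm Hz; unfold unit_disc in Hz.
  apply Rle_lt_trans with (1 := Cmod_exp_le _).
  rewrite Cmod_mult, Cmod_R, Rabs_pos_eq by lra.
  apply exp_increasing. nra.
Qed.

(** With [c = e^{-m}], the modulus is at least [1 + c - c |e^{mz}|], and
    [c |e^{mz}| < c e^m = 1]. *)
Lemma Cmod_poisson_slope_gt (m : R) (z : C) : 0 < m -> unit_disc z ->
  exp (- m) < Cmod (poisson_slope m z).
Proof.
  intros Hm Hz.
  assert (HE := Cmod_exp_scal_lt m z Hm Hz).
  assert (He := exp_pos (- m)).
  assert (Hem := exp_mul_exp_opp m).
  unfold poisson_slope.
  replace (0 * z + (1 + RtoC (exp (- m))) + - RtoC (exp (- m)) * C_exp (RtoC m * z))%C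
    with (RtoC (1 + exp (- m)) + - (RtoC (exp (- m)) * C_exp (RtoC m * z)))%C
    by (rewrite RtoC_plus; ring).
  apply Rlt_le_trans with (2 := Cmod_add_ge _ _).
  rewrite Cmod_opp, Cmod_mult, !Cmod_R, !Rabs_pos_eq by lra.
  nra.
Qed.

Lemma Cmod_poisson_slope_deriv_le (m : R) (z : C) : 0 < m -> unit_disc z ->
  Cmod (z * poisson_slope_deriv m z)%C <= m.
Proof.
  intros Hm Hz.
  assert (HE := Cmod_exp_scal_lt m z Hm Hz).
  assert (He := exp_pos (- m)).
  assert (Hem := exp_mul_exp_opp m).
  unfold poisson_slope_deriv, unit_disc in *.
  rewrite Cplus_0_l, !Cmod_mult, Cmod_opp, !Cmod_R, !Rabs_pos_eq by lra.
  assert (Hz0 := Cmod_ge_0 z); assert (HE0 := Cmod_ge_0 (C_exp (RtoC m * z))).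
  apply Rle_trans with (1 * (exp (- m) * m * exp m)).
  - apply Rmult_le_compat; [exact Hz0 | | lra |].
    + apply Rmult_le_pos; [nra | exact HE0].
    + apply Rmult_le_compat_l; [nra | lra].
  - apply Req_le. replace (1 * (exp (- m) * m * exp m)) with (exp m * exp (- m) * m) by ring.
    rewrite Hem; ring.
Qed.

Lemma S_condition_of_le (m k lambda : R) (z : C) :
  0 < m -> 0 < k <= 1 -> 0 <= lambda < 1 ->
  ((1 - lambda) + k * (1 + lambda)) * m * exp m <= 2 * k ->
  unit_disc z ->
  let f := (fun z => z * poisson_slope m z)%C in
  (z <> 0 -> S_denominator lambda f z <> 0) /\
  (S_quotient lambda f z + 1 <> 0)%C /\
  Cmod ((S_quotient lambda f z - 1) / (S_quotient lambda f z + 1))%C < k.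
Proof.
  intros Hm Hk Hl Hle Hz f.
  (* At 0 the quotient takes its default value 1, and the ratio is 0. *)
  destruct (Ceq_dec z 0) as [Ez|Ez].
  { subst z. split; [intros H; now elim H|].
    unfold S_quotient; destruct (Ceq_dec 0 0) as [_|E]; [|now elim E].
    split.
    - rewrite <- RtoC_plus; intros H; apply RtoC_inj in H; lra.
    - replace ((1 - 1) / (1 + 1))%C with (RtoC 0).
      + rewrite Cmod_0; lra.
      + field. }
  assert (Hp := Cmod_poisson_slope_gt m z Hm Hz).
  assert (Ht := Cmod_poisson_slope_deriv_le m z Hm Hz).
  assert (Hd := poisson_F_C_derive m z Hm).
  unfold f; rewrite (S_denominator_mul_id lambda _ _ _ Hd).
  assert (HQ := S_quotient_mul_id lambda _ _ _ Ez Hd).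
  set (p := poisson_slope m z) in *.
  set (t := (z * poisson_slope_deriv m z)%C) in *.
  assert (Ht0 := Cmod_ge_0 t).
  set (A := (1 - lambda) + k * (1 + lambda)) in *.
  assert (HA : 0 < A) by (unfold A; nra).
  (* The hypothesis times [e^{-m}] gives [A m <= 2 k e^{-m}]; strictness comes from the lower bound
     on [Cmod p]. *)
  assert (Hmain : A * Cmod t < 2 * k * Cmod p).
  { apply Rle_lt_trans with (2 * k * exp (- m)); [|nra].
    apply Rle_trans with (A * m); [nra|].
    assert (Hem := exp_mul_exp_opp m).
    assert (He := exp_pos (- m)).
    replace (A * m) with (A * m * (exp m * exp (- m))) by (rewrite Hem; ring).
    nra. }
  (* Here [A - 2 k lambda = (1 - lambda)(1 + k)]. *)
  assert (H1 : lambda * Cmod t < Cmod p).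
  { apply (Rmult_lt_reg_l (2 * k)); [lra|].
    apply Rle_lt_trans with (2 := Hmain).
    assert (0 <= A - 2 * k * lambda) by (unfold A; nra). nra. }
  (* From [A >= k (1 + lambda)]. *)
  assert (H2 : (1 + lambda) * Cmod t < 2 * Cmod p).
  { apply (Rmult_lt_reg_l k); [lra|]. unfold A in Hmain. nra. }
  assert (HD1 : (p + RtoC lambda * t)%C <> 0).
  { apply Cmod_gt_0. apply Rlt_le_trans with (2 := Cmod_add_ge _ _).
    rewrite Cmod_mult, Cmod_R, Rabs_pos_eq by lra. lra. }
  assert (HD2le : 2 * Cmod p - (1 + lambda) * Cmod t
                  <= Cmod (2 * p + RtoC (1 + lambda) * t)%C).
  { apply Rle_trans with (2 := Cmod_add_ge _ _).
    rewrite !Cmod_mult, !Cmod_R, !Rabs_pos_eq by lra. lra. }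
  assert (HD2 : (2 * p + RtoC (1 + lambda) * t)%C <> 0) by (apply Cmod_gt_0; lra).
  rewrite (HQ HD1).
  split; [intros _; now apply Cmult_neq_0|].
  split.
  - rewrite cayley_plus_1 by exact HD1.
    intros H. apply HD2.
    rewrite <- (Cmult_0_l (p + RtoC lambda * t)), <- H. field; exact HD1.
  - rewrite cayley_ratio by assumption.
    rewrite Cmod_div, Cmod_mult, Cmod_R, Rabs_pos_eq by (assumption || lra).
    apply (Rmult_lt_reg_r (Cmod (2 * p + RtoC (1 + lambda) * t))); [lra|].
    unfold Rdiv; rewrite Rmult_assoc, Rinv_l, Rmult_1_r by lra.
    (* [Hmain] rearranges to [(1 - lambda)|t| < k (2|p| - (1 + lambda)|t|)]; [HD2le] then
       concludes. *)
    unfold A in Hmain. nra.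
Qed.

(** * Necessity, from a point on the real axis *)

(* [k D - (1 - lambda) r |p'(r)|] with [D = 2 p(r) + (1 + lambda) r p'(r)] and
   [p = poisson_slope m]: at a real zero [r] in (0, 1) the quantity compared with [k]
   has modulus exactly [k]. *)
Definition boundary_gap (m k lambda r : R) : R :=
  2 * k * (1 + exp (- m) - exp (- m) * exp (m * r))
  - ((1 - lambda) + k * (1 + lambda)) * (r * (exp (- m) * m * exp (m * r))).

Lemma boundary_gap_zero (m k lambda : R) :
  0 < m -> 0 < k <= 1 -> 0 <= lambda < 1 ->
  2 * k < ((1 - lambda) + k * (1 + lambda)) * m * exp m ->
  exists r, 0 < r < 1 /\ boundary_gap m k lambda r = 0.
Proof.
  intros Hm Hk Hl Hlt.
  assert (Hem := exp_mul_exp_opp m).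
  assert (He := exp_pos (- m)).
  assert (H0 : boundary_gap m k lambda 0 = 2 * k)
    by (unfold boundary_gap; rewrite Rmult_0_r, exp_0; ring).
  assert (H1 : boundary_gap m k lambda 1 < 0).
  { unfold boundary_gap; rewrite Rmult_1_r.
    set (A := (1 - lambda) + k * (1 + lambda)) in *.
    (* The second summand vanishes; the first is negative by [Hlt]. *)
    replace (_ - _) with ((2 * k - A * m * exp m) * exp (- m) + 2 * k * (1 - exp m * exp (- m)))
      by ring.
    rewrite Hem. nra. }
  (* [IVT] expects a change from negative to positive, hence the sign. Its root lies in the closed
     interval; the nonzero endpoint values exclude 0 and 1. *)
  destruct (IVT (fun r => - boundary_gap m k lambda r) 0 1) as [r [Hr Hr0]].
  - unfold boundary_gap; reg.
  - lra.
  - rewrite H0; lra.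
  - lra.
  - exists r; assert (Hr1 : boundary_gap m k lambda r = 0) by lra.
    split; [|exact Hr1].
    destruct (Req_dec r 0) as [->|]; [lra|].
    destruct (Req_dec r 1) as [->|]; lra.
Qed.

Theorem theorem4p1 (m k lambda : R) :
  0 < m -> 0 < k <= 1 -> 0 <= lambda < 1 ->
  (class_C k lambda (poisson_G m) <->
   ((1 - lambda) + k * (1 + lambda)) * m * exp m <= 2 * k).
Proof.
  intros Hm Hk Hl.
  rewrite class_C_poisson_G_iff by exact Hm.
  split; [|intros Hle z Hz; exact (S_condition_of_le m k lambda z Hm Hk Hl Hle Hz)].
  intros H; apply Rnot_lt_le; intros Hlt.
  destruct (boundary_gap_zero m k lambda Hm Hk Hl Hlt) as [r [Hr Hgap]].
  assert (Hz : unit_disc (RtoC r)) by (unfold unit_disc; rewrite Cmod_R, Rabs_pos_eq; lra).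
  assert (Hr0 : RtoC r <> 0) by (intros E; apply RtoC_inj in E; lra).
  destruct (H _ Hz) as [Hden [Hnum Hlt_k]]; clear H.
  assert (Hd := poisson_F_C_derive m (RtoC r) Hm).
  specialize (Hden Hr0).
  rewrite (S_denominator_mul_id lambda _ _ _ Hd) in Hden.
  assert (HQ := S_quotient_mul_id lambda _ _ _ Hr0 Hd).
  (* At the real point [r] everything is real: the slope is [v] and its derivative is [- u]. *)
  set (u := exp (- m) * m * exp (m * r)).
  set (v := 1 + exp (- m) - exp (- m) * exp (m * r)).
  assert (Hu : (RtoC r * poisson_slope_deriv m (RtoC r))%C = RtoC (- (r * u))).
  { unfold poisson_slope_deriv, u.
    rewrite <- (RtoC_mult m r), C_exp_RtoC, RtoC_opp, !RtoC_mult. ring. }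
  assert (Hv : poisson_slope m (RtoC r) = RtoC v).
  { unfold poisson_slope, v.
    rewrite <- (RtoC_mult m r), C_exp_RtoC, RtoC_minus, RtoC_plus, !RtoC_mult. ring. }
  rewrite Hu, Hv in *.
  assert (Hu0 : 0 < r * u).
  { unfold u; repeat apply Rmult_lt_0_compat; try lra; apply exp_pos. }
  assert (HD1 : (RtoC v + RtoC lambda * RtoC (- (r * u)))%C <> 0)
    by (intros E; apply Hden; rewrite E; ring).
  rewrite (HQ HD1) in *.
  set (D := 2 * v - (1 + lambda) * (r * u)).
  (* The vanishing gap, rewritten. It forces [D > 0], so the reduced ratio has a nonzero
     denominator. *)
  assert (HkD : k * D = (1 - lambda) * (r * u)).
  { unfold boundary_gap in Hgap; fold u v in Hgap. unfold D; lra. }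
  assert (HD : 0 < D).
  { apply (Rmult_lt_reg_l k); [lra|]. rewrite HkD, Rmult_0_r.
    apply Rmult_lt_0_compat; lra. }
  assert (HDC : (2 * RtoC v + RtoC (1 + lambda) * RtoC (- (r * u)))%C = RtoC D).
  { rewrite <- !RtoC_mult, <- RtoC_plus. f_equal; unfold D; ring. }
  rewrite cayley_ratio in Hlt_k; [|exact HD1|].
  2: { rewrite HDC; intros E; apply RtoC_inj in E; lra. }
  rewrite HDC, <- RtoC_mult, <- RtoC_div, Cmod_R in Hlt_k by lra.
  (* The ratio equals [- k], so the strict bound would read [k < k]. *)
  replace ((1 - lambda) * - (r * u) / D) with (- k) in Hlt_k.
  - rewrite Rabs_Ropp, Rabs_pos_eq in Hlt_k; lra.
  - apply (Rmult_eq_reg_r D); [|lra]. unfold Rdiv.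
    rewrite Rmult_assoc, Rinv_l, Rmult_1_r by lra. lra.
Qed.
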